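(* For all $x,y>0$ and all $p>2$, with $p'=p/(p-1)$, $A=(x+y)/2$, $G=\sqrt{xy}$, $M_p=M_p(x,y)$ and $M_{p'}=M_{p'}(x,y)$, $$1-\left(\frac{A}{M_p}\right)^{p'}\ \ge\ \frac12\left(1-\left(\frac{G}{M_p}\right)^2\right)\ \ge\ \frac12\left(1-\left(\frac{G}{M_{p'}}\right)^2\right)\ \ge\ 1-\left(\frac{A}{M_{p'}}\right)^{p}.$$
   Context: For $x,y>0$ and real $q\neq0$, the $q$th power mean is $M_q(x,y)=\left((x^q+y^q)/2\right)^{1/q}$. *)

(* Defs.v *)
From Stdlib Require Import Reals.
Open Scope R_scope.

(* Intended for [0 < x], [0 < y] and [q <> 0]; [Rpower a b = exp (b * ln a)]
   is the usual real power for [0 < a]. *)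
Definition power_mean (q x y : R) : R :=
  Rpower ((Rpower x q + Rpower y q) / 2) (1 / q).

(* Main.v *)
Require Import Defs.
From Stdlib Require Import Reals Psatz.
From Coquelicot Require Import Coquelicot.
Open Scope R_scope.

(** Put [x = G e^t], [y = G e^(-t)] and [L = ln (cosh (p t)) / p], so that
    [M_p = G e^L] and [A = G cosh t]. The first and third inequalities say that
    [F = (2 - p) L + (p - 1) ln ((e^(2 L) + 1) / 2) - p ln (cosh t)] is nonnegative
    for [p > 2] and nonpositive for [1 < p < 2] ([p'] is conjugate to [p], and [p] to
    [p']). [F] vanishes at [0] and tends to [0] at infinity, so it is enough that [F']
    changes sign only once, in the right direction. The property "once negative,
    negative forever" passes from a derivative to a function which is nonnegative at
    [0], so signs can be traced back: [F'] has the sign of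
    [W = 2 L + ln v - ln u], where [v = p sinh ((p - 1) t)] and
    [u = (p - 1) sinh ((p + 1) t) - sinh ((p - 1) t)]; [W] vanishes at [0], and [W']
    has the sign of
    [E = - sinh ((3p - 2) t) + (p - 1)^2 sinh ((p + 2) t) - 2 (p - 2) sinh (p t)
         - (p^2 - 2) sinh ((p - 2) t)].
    The operators [f'' - b^2 f] also transport the property, and each removes one
    term of [E], until the sign is evident. The middle inequality is the monotonicity
    of power means. *)

Ltac prod_pos :=
  lazymatch goal with
  | |- 0 < _ * _ => apply Rmult_lt_0_compat; prod_pos
  | |- 0 <= _ * _ => apply Rmult_le_pos; prod_pos
  | |- _ => nra
  end.

(** * Persistent negativity, and its transport from a derivative to a function *)

Definition sticky (f : R -> R) : Prop :=
  forall s t, 0 < s <= t -> f s < 0 -> f t < 0.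

Lemma cosh_pos (z : R) : 0 < cosh z.
Proof. unfold cosh. pose proof (exp_pos z). pose proof (exp_pos (- z)). lra. Qed.

Lemma sinh_pos (z : R) : 0 < z -> 0 < sinh z.
Proof. intros hz. rewrite <- sinh_0. now apply sinh_lt. Qed.

Lemma is_derive_cosh_scal (k t : R) :
  is_derive (fun t => cosh (k * t)) t (k * sinh (k * t)).
Proof. unfold cosh, sinh. auto_derive; [easy | field]. Qed.

Lemma is_derive_sinh_scal (k t : R) :
  is_derive (fun t => sinh (k * t)) t (k * cosh (k * t)).
Proof. unfold cosh, sinh. auto_derive; [easy | field]. Qed.

Lemma mean_value (f df : R -> R) (a b : R) :
  a < b -> (forall t, a <= t <= b -> is_derive f t (df t)) ->
  exists c, a <= c <= b /\ f b - f a = df c * (b - a).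
Proof.
  intros hab hd.
  destruct (MVT_gen f a b df) as [c hc].
  - rewrite Rmin_left, Rmax_right by lra. intros; apply hd; lra.
  - rewrite Rmin_left, Rmax_right by lra. intros t ht.
    apply continuity_pt_filterlim, (ex_derive_continuous f t).
    exists (df t). apply hd; lra.
  - rewrite Rmin_left, Rmax_right in hc by lra. now exists c.
Qed.

(** If [f s < 0], the third hypothesis gives [r < s] with [f r > f s], so the mean value theorem
    finds [c <= s] with [g c < 0]; [g] stays negative after [c] and [f] decreases from [s] on. That
    hypothesis stands for a nonnegative lower limit at 0, so that [f 0] itself need not be
    meaningful. The decrease, stronger than negativity, is what later contradicts a limit 0 at
    infinity. *)
Lemma sticky_integral_decr (f g k : R -> R) :
  (forall t, 0 < t -> is_derive f t (k t * g t)) ->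
  (forall t, 0 < t -> 0 < k t) ->
  (forall e s, 0 < e -> 0 < s -> exists r, 0 < r < s /\ - e < f r) ->
  sticky g ->
  forall s t, 0 < s <= t -> f s < 0 -> f t <= f s.
Proof.
  intros hd hk h0 hg s t hst hs.
  destruct (h0 (- f s) s) as [r [hr hfr]]; [lra | lra |].
  destruct (mean_value f (fun t => k t * g t) r s) as [c [hc e1]];
    [lra | intros; apply hd; lra |].
  assert (hgc : g c < 0).
  { assert (k c * g c < 0) by nra. pose proof (hk c). nra. }
  destruct (proj2 hst) as [hlt | ->]; [| lra].
  destruct (mean_value f (fun t => k t * g t) s t) as [c' [hc' e2]];
    [lra | intros; apply hd; lra |].
  assert (hgc' : g c' < 0) by (apply (hg c c'); lra).
  pose proof (hk c' ltac:(lra)).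
  assert (k c' * g c' < 0) by nra. nra.
Qed.

Lemma sticky_integral (f g k : R -> R) :
  (forall t, 0 < t -> is_derive f t (k t * g t)) ->
  (forall t, 0 < t -> 0 < k t) ->
  (forall e s, 0 < e -> 0 < s -> exists r, 0 < r < s /\ - e < f r) ->
  sticky g -> sticky f.
Proof.
  intros hd hk h0 hg s t hst hs.
  pose proof (sticky_integral_decr f g k hd hk h0 hg s t hst hs). lra.
Qed.

Lemma continuous_near_0 (f : R -> R) (e s : R) :
  continuous f 0 -> 0 < e -> 0 < s ->
  exists r, 0 < r < s /\ Rabs (f r - f 0) < e.
Proof.
  intros hc he hs.
  destruct (proj1 (filterlim_locally f (f 0)) hc (mkposreal e he)) as [d hd].
  pose proof (cond_pos d) as hdp.
  assert (hm : 0 < Rmin s d) by (apply Rmin_glb_lt; lra).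
  pose proof (Rmin_l s d). pose proof (Rmin_r s d).
  exists (Rmin s d / 2). split; [lra |].
  apply hd. unfold ball; simpl; unfold AbsRing_ball, abs, minus, plus, opp; simpl.
  rewrite Rabs_pos_eq; lra.
Qed.

Lemma continuous_near_0_ge (f : R -> R) (e s : R) :
  continuous f 0 -> 0 <= f 0 -> 0 < e -> 0 < s ->
  exists r, 0 < r < s /\ - e < f r.
Proof.
  intros hc h0 he hs.
  destruct (continuous_near_0 f e s hc he hs) as [r [hr h]].
  exists r. split; [lra |]. apply Rabs_def2 in h. lra.
Qed.

(** * Combinations of four hyperbolic sines, and elimination of their frequencies *)

Definition sinh_sum (a1 k1 a2 k2 a3 k3 a4 k4 t : R) : R :=
  a1 * sinh (k1 * t) + a2 * sinh (k2 * t) + a3 * sinh (k3 * t) + a4 * sinh (k4 * t).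

(* [wronskian' = cosh (b t) (f'' - b^2 f)] and [(f / cosh (b t))' = wronskian / cosh^2 (b t)];
   here [g = f'' - b^2 f], from which a frequency [k_i = b] has disappeared. *)
Section Elimination.
Variables (a1 k1 a2 k2 a3 k3 a4 k4 b : R).

Let f := sinh_sum a1 k1 a2 k2 a3 k3 a4 k4.
Let f' t := a1 * (k1 * cosh (k1 * t)) + a2 * (k2 * cosh (k2 * t))
  + a3 * (k3 * cosh (k3 * t)) + a4 * (k4 * cosh (k4 * t)).
Let g := sinh_sum (a1 * (k1 ^ 2 - b ^ 2)) k1 (a2 * (k2 ^ 2 - b ^ 2)) k2
                  (a3 * (k3 ^ 2 - b ^ 2)) k3 (a4 * (k4 ^ 2 - b ^ 2)) k4.
Let wronskian t := f' t * cosh (b * t) - f t * (b * sinh (b * t)).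

Let is_derive_wronskian t :
  is_derive wronskian t (cosh (b * t) * g t).
Proof.
  unfold wronskian, f, f', g, sinh_sum, cosh, sinh.
  auto_derive; [easy | field].
Qed.

Let is_derive_quotient t :
  is_derive (fun t => f t / cosh (b * t)) t (/ cosh (b * t) ^ 2 * wronskian t).
Proof.
  pose proof (cosh_pos (b * t)) as hc.
  unfold wronskian, f, f', g, sinh_sum. unfold cosh, sinh in *.
  auto_derive; [lra | field; lra].
Qed.

Let wronskian_0 : wronskian 0 = a1 * k1 + a2 * k2 + a3 * k3 + a4 * k4.
Proof.
  unfold wronskian, f, f', sinh_sum. rewrite !Rmult_0_r, cosh_0, sinh_0. ring.
Qed.

Let quotient_0 : f 0 / cosh (b * 0) = 0.
Proof.
  unfold f, sinh_sum. rewrite !Rmult_0_r, cosh_0, sinh_0. field.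
Qed.

(** The hypothesis is [0 <= wronskian 0], that is, a nonnegative derivative of [f] at 0, and the
    quotient vanishes at 0. So the property climbs from [g] to [wronskian], to the quotient, and to
    [f] because [cosh] is positive. *)
Lemma sticky_sinh_sum :
  0 <= a1 * k1 + a2 * k2 + a3 * k3 + a4 * k4 -> sticky g -> sticky f.
Proof.
  intros h0 hg.
  assert (hw : sticky wronskian).
  { apply (sticky_integral _ g (fun t => cosh (b * t))).
    - intros; apply is_derive_wronskian.
    - intros; apply cosh_pos.
    - intros e s he hs. apply continuous_near_0_ge; try lra.
      apply (ex_derive_continuous wronskian). eexists. apply is_derive_wronskian.
    - exact hg. }
  assert (hq : sticky (fun t => f t / cosh (b * t))).
  { apply (sticky_integral _ wronskian (fun t => / cosh (b * t) ^ 2)).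
    - intros; apply is_derive_quotient.
    - intros. apply Rinv_0_lt_compat, pow_lt, cosh_pos.
    - intros e s he hs. apply (continuous_near_0_ge (fun t => f t / cosh (b * t)));
        try lra.
      apply (ex_derive_continuous (fun t => f t / cosh (b * t))).
      eexists. apply is_derive_quotient.
    - exact hw. }
  intros s t hst hs.
  assert (hqs : f s / cosh (b * s) < 0).
  { pose proof (Rinv_0_lt_compat _ (cosh_pos (b * s))). unfold Rdiv. nra. }
  pose proof (hq s t hst hqs) as hqt; simpl in hqt.
  pose proof (cosh_pos (b * t)) as hc.
  replace (f t) with (f t / cosh (b * t) * cosh (b * t)) by (field; lra). nra.
Qed.

(** Counterpart for a nonpositive derivative at 0: two integrations from 0 then transport negativity
    itself. *)
Lemma sinh_sum_neg :
  a1 * k1 + a2 * k2 + a3 * k3 + a4 * k4 <= 0 ->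
  (forall t, 0 < t -> g t < 0) -> forall t, 0 < t -> f t < 0.
Proof.
  intros h0 hg t ht.
  assert (hwn : forall s, 0 < s -> wronskian s < 0).
  { intros s hs.
    (* [mean_value] may return an endpoint, and [g] vanishes at 0. Cutting at [s / 2] gives a strict
       decrease on the right half and a weak one on the left half. *)
    destruct (mean_value wronskian (fun t => cosh (b * t) * g t) (s / 2) s)
      as [c [hc e]]; [lra | intros; apply is_derive_wronskian |].
    destruct (mean_value wronskian (fun t => cosh (b * t) * g t) 0 (s / 2))
      as [c' [hc' e']]; [lra | intros; apply is_derive_wronskian |].
    assert (cosh (b * c) * g c < 0).
    { pose proof (cosh_pos (b * c)). pose proof (hg c ltac:(lra)). nra. }
    assert (cosh (b * c') * g c' <= 0).
    { pose proof (cosh_pos (b * c')).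
      destruct (Rle_lt_or_eq_dec 0 c' ltac:(lra)) as [h | <-].
      - pose proof (hg c' h). nra.
      - unfold g, sinh_sum. rewrite !Rmult_0_r, sinh_0. lra. }
    nra. }
  destruct (mean_value (fun t => f t / cosh (b * t))
              (fun t => / cosh (b * t) ^ 2 * wronskian t) (t / 2) t) as [c [hc e]];
    [lra | intros; apply is_derive_quotient |].
  destruct (mean_value (fun t => f t / cosh (b * t))
              (fun t => / cosh (b * t) ^ 2 * wronskian t) 0 (t / 2)) as [c' [hc' e']];
    [lra | intros; apply is_derive_quotient |].
  assert (hneg : f t / cosh (b * t) < 0).
  { rewrite quotient_0 in e'.
    assert (hk : forall c, 0 < / cosh (b * c) ^ 2)
      by (intros; apply Rinv_0_lt_compat, pow_lt, cosh_pos).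
    assert (/ cosh (b * c) ^ 2 * wronskian c < 0)
      by (pose proof (hk c); pose proof (hwn c ltac:(lra)); nra).
    assert (/ cosh (b * c') ^ 2 * wronskian c' <= 0).
    { pose proof (hk c').
      destruct (Rle_lt_or_eq_dec 0 c' ltac:(lra)) as [h | <-].
      - pose proof (hwn c' h). nra.
      - rewrite wronskian_0. nra. }
    nra. }
  pose proof (cosh_pos (b * t)) as hc0.
  replace (f t) with (f t / cosh (b * t) * cosh (b * t)) by (field; lra). nra.
Qed.

End Elimination.

(** * Persistence of the sign of [crit] *)

(* [crit], [slope] and [gap] below are [E], [W] and [F] of the header. *)
Definition crit (p : R) : R -> R :=
  sinh_sum (-1) (3 * p - 2) ((p - 1) ^ 2) (p + 2) (-2 * (p - 2)) p (-(p ^ 2 - 2)) (p - 2).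

Lemma sticky_crit (p : R) : 2 < p -> sticky (crit p).
Proof.
  intros hp. unfold crit.
  (* The derivative of [crit p] at 0 is exactly 0. The choices [p + 2] and then [3 * p - 2] remove
     the second and the first term; for [p > 2] both remaining coefficients are negative. *)
  apply (sticky_sinh_sum _ _ _ _ _ _ _ _ (p + 2)); [right; ring |].
  apply (sticky_sinh_sum _ _ _ _ _ _ _ _ (3 * p - 2)).
  { match goal with |- 0 <= ?e =>
      replace e with (8 * (p * ((p - 1) ^ 2 * (p - 2)))) by ring end.
    prod_pos. }
  intros s t hst _.
  unfold sinh_sum.
  assert (0 < sinh (p * t)) by (apply sinh_pos; nra).
  assert (0 < sinh ((p - 2) * t)) by (apply sinh_pos; nra).
  match goal with |- ?e < 0 =>
    replace e with (- (64 * ((p - 2) * (p - 1) * (2 * p - 1) * (p + 1)) * (sinh (p * t) / 2)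
      + 64 * (p ^ 2 - 2) * p ^ 2 * (p - 1) * sinh ((p - 2) * t))) by field end.
  apply Ropp_lt_gt_0_contravar, Rlt_gt.
  apply Rplus_lt_0_compat; prod_pos.
Qed.

Lemma sticky_opp_crit (p : R) : 1 < p < 2 -> sticky (fun t => - crit p t).
Proof.
  intros hp.
  assert (h : sticky (sinh_sum 1 (3 * p - 2) (- (p - 1) ^ 2) (p + 2)
                        (2 * (p - 2)) p (p ^ 2 - 2) (p - 2))).
  { apply (sticky_sinh_sum _ _ _ _ _ _ _ _ (p + 2)); [right; ring |].
    apply (sticky_sinh_sum _ _ _ _ _ _ _ _ (3 * p - 2)).
    { match goal with |- 0 <= ?e =>
        replace e with (8 * (p * ((p - 1) ^ 2 * (2 - p)))) by ring end.
      prod_pos. }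
    intros s t hst _. revert t hst.
    (* For [p < 2] the factor [p ^ 2 - 2] changes sign at the square root of 2, so the sign of the
       last term is not evident. A third elimination, with [b = p - 2], removes it; the derivative
       at 0 is now nonpositive, hence the use of [sinh_sum_neg]. *)
    assert (hneg := sinh_sum_neg
      (1 * ((3 * p - 2) ^ 2 - (p + 2) ^ 2) * ((3 * p - 2) ^ 2 - (3 * p - 2) ^ 2)) (3 * p - 2)
      (- (p - 1) ^ 2 * ((p + 2) ^ 2 - (p + 2) ^ 2) * ((p + 2) ^ 2 - (3 * p - 2) ^ 2)) (p + 2)
      (2 * (p - 2) * (p ^ 2 - (p + 2) ^ 2) * (p ^ 2 - (3 * p - 2) ^ 2)) p
      ((p ^ 2 - 2) * ((p - 2) ^ 2 - (p + 2) ^ 2) * ((p - 2) ^ 2 - (3 * p - 2) ^ 2)) (p - 2)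
      (p - 2)).
    intros t hst. apply hneg; [| clear t hst | lra].
    - match goal with |- ?e <= 0 =>
        replace e with (- (32 * p * (2 - p) * (p - 1) ^ 2 * (2 * p ^ 2 + 4 * p + 1))) by ring end.
      assert (0 <= 32 * p * (2 - p) * (p - 1) ^ 2 * (2 * p ^ 2 + 4 * p + 1));
        [| lra].
      prod_pos.
    - intros t ht. unfold sinh_sum.
      assert (0 < sinh (p * t)) by (apply sinh_pos; nra).
      match goal with |- ?e < 0 =>
        replace e with (- (128 * (2 - p) * (p - 1) * (2 * p - 1) * (p + 1) * (p - 1)
                           * sinh (p * t))) by ring end.
      apply Ropp_lt_gt_0_contravar, Rlt_gt.
      prod_pos. }
  intros s t hst hs.
  replace (- crit p t) with (sinh_sum 1 (3 * p - 2) (- (p - 1) ^ 2) (p + 2)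
    (2 * (p - 2)) p (p ^ 2 - 2) (p - 2) t) by (unfold crit, sinh_sum; ring).
  apply (h s t hst).
  unfold crit, sinh_sum in *. lra.
Qed.

(** * Elementary hyperbolic inequalities *)

Lemma cosh_le (a b : R) : 0 <= a <= b -> cosh a <= cosh b.
Proof.
  intros [ha [hab | ->]]; [| lra].
  destruct (mean_value (fun t => cosh (1 * t)) (fun t => 1 * sinh (1 * t)) a b)
    as [c [hc e]]; [easy | intros; apply is_derive_cosh_scal |].
  rewrite !Rmult_1_l in e.
  assert (0 <= sinh c).
  { destruct (Rle_lt_or_eq_dec 0 c ltac:(lra)) as [h | <-].
    - left. now apply sinh_pos.
    - rewrite sinh_0. lra. }
  nra.
Qed.

Lemma cosh_ge_1 (z : R) : 1 <= cosh z.
Proof.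
  unfold cosh. pose proof (exp_ineq1_le z). pose proof (exp_ineq1_le (- z)). lra.
Qed.

Lemma sinh_bounds (z : R) : 0 < z -> z <= sinh z <= z * cosh z.
Proof.
  intros hz.
  destruct (mean_value (fun t => sinh (1 * t)) (fun t => 1 * cosh (1 * t)) 0 z)
    as [c [hc e]]; [easy | intros; apply is_derive_sinh_scal |].
  rewrite !Rmult_1_l, sinh_0 in e.
  pose proof (cosh_ge_1 c). pose proof (cosh_le c z hc). nra.
Qed.

Lemma cosh_Rabs (q t : R) : cosh (q * Rabs t) = cosh (q * t).
Proof.
  unfold Rabs. destruct Rcase_abs; [| easy].
  unfold cosh. rewrite Ropp_mult_distr_r, Ropp_involutive.
  rewrite Ropp_mult_distr_r_reverse. lra.
Qed.

(** * Logarithms of the means, and the gap between the two sides *)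

(* [exp (log_mean p t)] is the power mean of order [p] of [exp t] and [exp (- t)]. *)
Definition log_mean (p t : R) : R := ln (cosh (p * t)) / p.

Definition gap (p t : R) : R :=
  (2 - p) * log_mean p t + (p - 1) * ln ((exp (2 * log_mean p t) + 1) / 2)
  - p * ln (cosh (1 * t)).

Lemma log_mean_0 (p : R) : log_mean p 0 = 0.
Proof. unfold log_mean. rewrite Rmult_0_r, cosh_0, ln_1. lra. Qed.

Lemma gap_0 (p : R) : gap p 0 = 0.
Proof.
  unfold gap. rewrite log_mean_0, !Rmult_0_r, exp_0, cosh_0.
  replace ((1 + 1) / 2) with 1 by lra. rewrite ln_1. ring.
Qed.

Lemma ln_nonneg (z : R) : 1 <= z -> 0 <= ln z.
Proof. intros [h | <-]; rewrite <- ln_1; [left; apply ln_increasing |]; lra. Qed.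

Lemma log_mean_nonneg (p t : R) : 0 < p -> 0 <= log_mean p t.
Proof.
  intros hp. unfold log_mean.
  apply Rdiv_le_0_compat; [apply ln_nonneg, cosh_ge_1 | easy].
Qed.

Lemma is_derive_log_mean (p t : R) :
  0 < p -> is_derive (log_mean p) t (sinh (p * t) / cosh (p * t)).
Proof.
  intros hp. pose proof (cosh_pos (p * t)).
  unfold log_mean, sinh, cosh in *. auto_derive; [lra |].
  field. lra.
Qed.

(** * The derivative of [slope] and its limit at 0 *)

Definition num (p t : R) : R := (p - 1) * sinh ((p + 1) * t) - sinh ((p - 1) * t).
Definition den (p t : R) : R := p * sinh ((p - 1) * t).

Lemma den_pos (p t : R) : 1 < p -> 0 < t -> 0 < den p t.
Proof.
  intros hp ht. apply Rmult_lt_0_compat; [lra |]. apply sinh_pos. nra.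
Qed.

(** The difference [den - num] is a combination of two hyperbolic sines with derivative 0 at 0;
    eliminating the frequency [p - 1] leaves a negative multiple of [sinh ((p + 1) * t)]. *)
Lemma den_le_num (p t : R) : 1 < p -> 0 < t -> den p t <= num p t.
Proof.
  intros hp ht.
  pose proof (sinh_sum_neg (p + 1) (p - 1) (- (p - 1)) (p + 1) 0 0 0 0 (p - 1)) as h.
  assert (sinh_sum (p + 1) (p - 1) (- (p - 1)) (p + 1) 0 0 0 0 t < 0).
  { apply h; [right; ring | | easy]. clear t ht h. intros t ht. unfold sinh_sum.
    assert (0 < sinh ((p + 1) * t)) by (apply sinh_pos; nra).
    match goal with |- ?e < 0 =>
      replace e with (- (4 * p * (p - 1) * sinh ((p + 1) * t))) by ring end.
    apply Ropp_lt_gt_0_contravar, Rlt_gt. prod_pos. }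
  unfold sinh_sum, num, den in *. lra.
Qed.

(** The factor on the right tends to 1 at 0, so with [den_le_num] it squeezes [num / den]. It comes
    from [sinh z <= z * cosh z] in [num] and [z <= sinh z] in [den]. *)
Lemma num_le_den (p t : R) :
  1 < p -> 0 < t -> num p t <= den p t * (((p + 1) * cosh ((p + 1) * t) - 1) / p).
Proof.
  intros hp ht. unfold num, den.
  assert (h1 := sinh_bounds ((p + 1) * t) ltac:(nra)).
  assert (h2 := sinh_bounds ((p - 1) * t) ltac:(nra)).
  replace (p * sinh ((p - 1) * t) * (((p + 1) * cosh ((p + 1) * t) - 1) / p))
    with (sinh ((p - 1) * t) * (p + 1) * cosh ((p + 1) * t) - sinh ((p - 1) * t))
    by (field; lra).
  assert ((p - 1) * sinh ((p + 1) * t) <= (p - 1) * t * ((p + 1) * cosh ((p + 1) * t)))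
    by nra.
  assert ((p - 1) * t * ((p + 1) * cosh ((p + 1) * t))
          <= sinh ((p - 1) * t) * ((p + 1) * cosh ((p + 1) * t))).
  { apply Rmult_le_compat_r; [| easy]. pose proof (cosh_pos ((p + 1) * t)). nra. }
  lra.
Qed.

Definition slope (p t : R) : R := 2 * log_mean p t + ln (den p t) - ln (num p t).

Lemma is_derive_slope (p t : R) :
  1 < p -> 0 < t ->
  is_derive (slope p) t (/ (2 * sinh ((p - 1) * t) * num p t * cosh (p * t)) * crit p t).
Proof.
  intros hp ht.
  pose proof (den_pos p t hp ht) as hd. pose proof (den_le_num p t hp ht) as hn.
  assert (hs : 0 < sinh ((p - 1) * t)) by (apply sinh_pos; nra).
  pose proof (cosh_pos (p * t)) as hc.
  pose proof (is_derive_log_mean p t ltac:(lra)) as hL.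
  apply (is_derive_ext (fun t => 2 * log_mean p t
     + ln (p * ((exp ((p - 1) * t) - exp (- ((p - 1) * t))) / 2))
     - ln ((p - 1) * ((exp ((p + 1) * t) - exp (- ((p + 1) * t))) / 2)
             - (exp ((p - 1) * t) - exp (- ((p - 1) * t))) / 2))); [easy |].
  evar_last.
  { auto_derive; [| reflexivity].
    split; [now exists (sinh (p * t) / cosh (p * t)) |].
    unfold den, num, sinh in *. split; [lra |]. split; [lra | easy]. }
  rewrite (is_derive_unique (log_mean p) t _ hL : Derive (fun x : R => log_mean p x) t = _).
  assert (hn' : 0 < num p t) by lra. clear hn hL hd.
  unfold crit, sinh_sum, num, cosh, sinh in *.
  assert (hX := exp_pos (p * t)). assert (hY := exp_pos t).
  replace ((p - 1) * t) with (p * t + - t) in * by ring.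
  replace ((p + 1) * t) with (p * t + t) in * by ring.
  replace ((3 * p - 2) * t) with (p * t + p * t + p * t + - t + - t) in * by ring.
  replace ((p + 2) * t) with (p * t + t + t) in * by ring.
  replace ((p - 2) * t) with (p * t + - t + - t) in * by ring.
  rewrite !Ropp_plus_distr, ?Ropp_involutive, !exp_plus, !exp_Ropp in *.
  set (X := exp (p * t)) in *. set (Y := exp t) in *.
  clearbody X Y.
  (* In [X] and [Y] the claim is a rational identity. This quantity is
     [2 * X * Y * sinh ((p - 1) * t)] and that of the next assertion is [2 * X * Y * num p t]; they
     are denominators in the call to [field]. *)
  assert (0 < X * X - Y * Y).
  { replace (X * X - Y * Y) with (2 * X * Y * ((X * / Y - / X * Y) / 2))
      by (field; lra).
    prod_pos. }
  assert (0 < (p - 1) * (X * Y * (X * Y) - 1) - (X * X - Y * Y)).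
  { match goal with |- 0 < ?e => replace e with
      (2 * X * Y * ((p - 1) * ((X * Y - / X * / Y) / 2) - (X * / Y - / X * Y) / 2))
      by (field; lra) end.
    apply Rmult_lt_0_compat; [prod_pos | easy]. }
  field. repeat split; nra.
Qed.

Lemma slope_near_0 (p e s : R) :
  1 < p -> 0 < e -> 0 < s -> exists r, 0 < r < s /\ Rabs (slope p r) < e.
Proof.
  intros hp he hs.
  (* At 0, [slope] would involve the logarithm of 0. [B] is continuous, vanishes at 0 and dominates
     the absolute value of [slope] on positive arguments, by [den_le_num] and [num_le_den]. *)
  set (B t := 2 * log_mean p t + ln (((p + 1) * cosh ((p + 1) * t) - 1) / p)).
  assert (hB0 : B 0 = 0).
  { unfold B. rewrite log_mean_0, !Rmult_0_r, cosh_0.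
    replace (((p + 1) * 1 - 1) / p) with 1 by (field; lra). rewrite ln_1. ring. }
  assert (hpos : forall t, 1 <= ((p + 1) * cosh ((p + 1) * t) - 1) / p).
  { intros t. pose proof (cosh_ge_1 ((p + 1) * t)).
    apply (Rmult_le_reg_r p); [lra |]. unfold Rdiv.
    rewrite Rmult_assoc, Rinv_l by lra. nra. }
  destruct (continuous_near_0 B e s) as [r [hr h]]; [| easy | easy |].
  { apply (ex_derive_continuous B). unfold B.
    apply (ex_derive_plus (fun t => 2 * log_mean p t)).
    - apply (ex_derive_scal (log_mean p)). eexists. apply is_derive_log_mean. lra.
    - pose proof (hpos 0) as h0. unfold cosh in *. auto_derive. lra. }
  exists r. split; [easy |].
  rewrite hB0, Rminus_0_r in h.
  eapply Rle_lt_trans; [| exact h].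
  pose proof (den_pos p r hp (proj1 hr)) as hd.
  pose proof (den_le_num p r hp (proj1 hr)) as hn.
  pose proof (num_le_den p r hp (proj1 hr)) as hn'.
  pose proof (log_mean_nonneg p r ltac:(lra)) as hL.
  pose proof (hpos r) as hr1.
  pose proof (ln_nonneg _ hr1) as hl.
  rewrite (Rabs_pos_eq (B r)) by (unfold B; lra).
  pose proof (ln_le _ _ hd hn).
  pose proof (ln_le (num p r) _ ltac:(lra) hn') as hle.
  rewrite ln_mult in hle by lra.
  unfold slope, B. apply Rabs_le. lra.
Qed.

(** * The derivative of [gap] *)

Lemma is_derive_gap (p t : R) :
  0 < p ->
  is_derive (gap p) t
    (/ ((exp (2 * log_mean p t) + 1) * cosh (p * t) * cosh t)
     * (exp (2 * log_mean p t) * den p t - num p t)).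
Proof.
  intros hp.
  pose proof (is_derive_log_mean p t hp) as hL.
  pose proof (exp_pos (2 * log_mean p t)) as hm.
  pose proof (cosh_pos (p * t)) as hc. pose proof (cosh_pos t) as hc1.
  apply (is_derive_ext (fun t => (2 - p) * log_mean p t
    + (p - 1) * ln ((exp (2 * log_mean p t) + 1) / 2)
    - p * ln ((exp (1 * t) + exp (- (1 * t))) / 2))); [easy |].
  evar_last.
  { auto_derive; [| reflexivity].
    assert (ex_derive (fun x => log_mean p x) t)
      by (now exists (sinh (p * t) / cosh (p * t))).
    repeat split; try easy; unfold cosh in hc1; rewrite ?Rmult_1_l; lra. }
  rewrite (is_derive_unique (log_mean p) t _ hL : Derive (fun x : R => log_mean p x) t = _).
  set (m := exp (2 * log_mean p t)) in *. clearbody m. clear hL.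
  unfold den, num, cosh, sinh in *.
  rewrite !Rmult_1_l.
  assert (hX := exp_pos (p * t)). assert (hY := exp_pos t).
  replace ((p - 1) * t) with (p * t + - t) in * by ring.
  replace ((p + 1) * t) with (p * t + t) in * by ring.
  rewrite !Ropp_plus_distr, ?Ropp_involutive, !exp_plus, !exp_Ropp in *.
  set (X := exp (p * t)) in *. set (Y := exp t) in *.
  clearbody X Y.
  field. repeat split; nra.
Qed.

(** * The limit of [gap] at infinity *)

Lemma exp_le_compat (a b : R) : a <= b -> exp a <= exp b.
Proof. intros [h | ->]; [left; now apply exp_increasing | lra]. Qed.

Lemma ln_1p_bounds (z : R) : 0 < z -> 0 <= ln (1 + z) <= z.
Proof.
  intros hz. split; [apply ln_nonneg; lra |].
  rewrite <- (ln_exp z) at 2. apply ln_le; [lra |]. apply exp_ineq1_le.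
Qed.

Lemma ln_cosh_eq (z : R) : ln (cosh z) = z - ln 2 + ln (1 + exp (- (2 * z))).
Proof.
  pose proof (exp_pos z). pose proof (exp_pos (- (2 * z))).
  replace (cosh z) with (exp z * (1 + exp (- (2 * z))) / 2).
  - rewrite ln_div, ln_mult, ln_exp by nra. ring.
  - unfold cosh. replace (- z) with (z + - (2 * z)) by ring. rewrite exp_plus. field.
Qed.

Lemma ln_half_1p_exp (z : R) :
  ln ((exp z + 1) / 2) = z - ln 2 + ln (1 + exp (- z)).
Proof.
  pose proof (exp_pos z). pose proof (exp_pos (- z)).
  assert (e : exp z * exp (- z) = 1) by (rewrite <- exp_plus, Rplus_opp_r; apply exp_0).
  replace (exp z + 1) with (exp z * (1 + exp (- z))) by lra.
  rewrite ln_div, ln_mult, ln_exp by nra. ring.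
Qed.

Lemma exp_opp_le_inv (z : R) : 0 < z -> exp (- z) <= / z.
Proof.
  intros hz. rewrite exp_Ropp. apply Rinv_le_contravar; [easy |].
  pose proof (exp_ineq1_le z). lra.
Qed.

(** Each logarithm is split into its linear asymptote and a vanishing remainder; the linear parts
    and the multiples of [ln 2] cancel. *)
Lemma gap_eq (p t : R) :
  0 < p ->
  gap p t = ln (1 + exp (- (2 * (p * t)))) + (p - 1) * ln (1 + exp (- (2 * log_mean p t)))
            - p * ln (1 + exp (- (2 * t))).
Proof.
  intros hp. unfold gap.
  rewrite ln_half_1p_exp, Rmult_1_l, (ln_cosh_eq t).
  assert (e : p * log_mean p t = p * t - ln 2 + ln (1 + exp (- (2 * (p * t))))).
  { rewrite <- ln_cosh_eq. unfold log_mean. field. lra. }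
  lra.
Qed.

Lemma gap_le_inv (p t : R) : 1 < p -> 2 <= t -> Rabs (gap p t) <= 2 * p / t.
Proof.
  intros hp ht. rewrite gap_eq by lra.
  (* [log_mean p t] is at least [t - ln 2 / p], hence at least [t - 1], and [t >= 2]. All three
     exponents of [gap_eq] are then at least [t] in absolute value, and each logarithm is at most
     [/ t]. *)
  assert (hL : t / 2 <= log_mean p t).
  { unfold log_mean. rewrite ln_cosh_eq.
    pose proof (ln_1p_bounds _ (exp_pos (- (2 * (p * t))))).
    assert (ln 2 <= 1).
    { rewrite <- (ln_exp 1). apply ln_le; [lra |]. pose proof (exp_ineq1_le 1). lra. }
    apply (Rmult_le_reg_r p); [lra |].
    unfold Rdiv. rewrite (Rmult_assoc _ (/ p)), Rinv_l by lra. nra. }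
  assert (h : forall z, t <= z -> 0 <= ln (1 + exp (- z)) <= / t).
  { intros z hz. pose proof (ln_1p_bounds _ (exp_pos (- z))).
    pose proof (exp_opp_le_inv z ltac:(lra)).
    assert (/ z <= / t) by (apply Rinv_le_contravar; lra). lra. }
  pose proof (h (2 * (p * t)) ltac:(nra)).
  pose proof (h (2 * log_mean p t) ltac:(lra)).
  pose proof (h (2 * t) ltac:(lra)).
  unfold Rdiv. apply Rabs_le. split; nra.
Qed.

Lemma gap_near_infinity (p e s : R) :
  1 < p -> 0 < e -> exists t, s <= t /\ Rabs (gap p t) < e.
Proof.
  intros hp he.
  assert (hq : 0 < 2 * p / e) by (apply Rdiv_lt_0_compat; lra).
  pose proof (Rmax_l s 2). pose proof (Rmax_r s 2).
  set (t := Rmax s 2 + 2 * p / e).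
  exists t. split; [unfold t; lra |].
  eapply Rle_lt_trans; [apply gap_le_inv; unfold t; lra |].
  assert (ht : 2 * p / e < t) by (unfold t; lra).
  apply (Rmult_lt_reg_r t); [lra |].
  unfold Rdiv at 1. rewrite Rmult_assoc, Rinv_l by lra.
  apply (Rmult_lt_compat_r e) in ht; [| easy].
  unfold Rdiv in ht. rewrite Rmult_assoc, Rinv_l in ht by lra. lra.
Qed.

(** * The sign of [gap], with [sg] treating both ranges of [p] together *)

Lemma sticky_scal_decr (sg : R) (f g k : R -> R) :
  (sg = 1 \/ sg = -1) ->
  (forall t, 0 < t -> is_derive f t (k t * g t)) ->
  (forall t, 0 < t -> 0 < k t) ->
  (forall e s, 0 < e -> 0 < s -> exists r, 0 < r < s /\ Rabs (f r) < e) ->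
  sticky (fun t => sg * g t) ->
  forall s t, 0 < s <= t -> sg * f s < 0 -> sg * f t <= sg * f s.
Proof.
  intros hsg hd hk h0 hg s t hst hs.
  refine (sticky_integral_decr (fun t => sg * f t) (fun t => sg * g t) k _ hk _ hg s t hst hs).
  - intros u hu. evar_last; [apply (is_derive_scal f), hd, hu |].
    simpl. ring.
  - intros e u he hu. destruct (h0 e u he hu) as [r [hr h]].
    exists r. split; [easy |]. apply Rabs_def2 in h.
    destruct hsg as [-> | ->]; lra.
Qed.

(** With [L = 2 * log_mean p t], this identifies the sign of the derivative of [gap] with the sign
    of [slope]. *)
Lemma ln_compare (sg L d n : R) :
  (sg = 1 \/ sg = -1) -> 0 < d -> 0 < n ->
  sg * (exp L * d - n) < 0 <-> sg * (L + ln d - ln n) < 0.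
Proof.
  intros hsg hd hn.
  pose proof (exp_pos L) as hL.
  assert (hp : 0 < exp L * d) by nra.
  assert (e : ln (exp L * d) = L + ln d) by (now rewrite ln_mult, ln_exp).
  rewrite <- e.
  destruct hsg as [-> | ->]; split; intros h.
  - pose proof (ln_increasing (exp L * d) n hp ltac:(lra)). lra.
  - pose proof (ln_lt_inv (exp L * d) n hp hn ltac:(lra)). lra.
  - pose proof (ln_increasing n (exp L * d) hn ltac:(lra)). lra.
  - pose proof (ln_lt_inv n (exp L * d) hn hp ltac:(lra)). lra.
Qed.

Lemma gap_sign (sg p t : R) :
  (sg = 1 /\ 2 < p) \/ (sg = -1 /\ 1 < p < 2) -> 0 <= t -> 0 <= sg * gap p t.
Proof.
  intros hsp ht.
  assert (hsg : sg = 1 \/ sg = -1) by tauto.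
  assert (hp : 1 < p) by lra.
  assert (hE : sticky (fun t => sg * crit p t)).
  { intros s r hsr. destruct hsp as [[-> h] | [-> h]].
    - rewrite !Rmult_1_l. now apply sticky_crit.
    - replace (-1 * crit p s) with (- crit p s) by ring.
      replace (-1 * crit p r) with (- crit p r) by ring.
      now apply (sticky_opp_crit p h s r). }
  assert (hn : forall t, 0 < t -> 0 < num p t).
  { intros u hu. pose proof (den_pos p u hp hu). pose proof (den_le_num p u hp hu). lra. }
  assert (hW : sticky (fun t => sg * slope p t)).
  { intros s r hsr hs.
    assert (sg * slope p r <= sg * slope p s); [| lra].
    revert hs. apply (sticky_scal_decr sg (slope p) (crit p)
      (fun t => / (2 * sinh ((p - 1) * t) * num p t * cosh (p * t)))); try easy.
    - intros u hu. now apply is_derive_slope.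
    - intros u hu. apply Rinv_0_lt_compat.
      pose proof (hn u hu). pose proof (cosh_pos (p * u)).
      assert (0 < sinh ((p - 1) * u)) by (apply sinh_pos; nra). prod_pos.
    - intros. now apply slope_near_0. }
  assert (hZ : sticky (fun t => sg * (exp (2 * log_mean p t) * den p t - num p t))).
  { intros s r hsr hs.
    apply ln_compare; [easy | apply den_pos; lra | apply hn; lra |].
    apply (hW s r hsr).
    apply ln_compare; [easy | apply den_pos; lra | apply hn; lra | easy]. }
  destruct ht as [ht | <-]; [| rewrite gap_0; lra].
  (* If [sg * gap p t] were negative, later values would stay below it, against the limit 0 at
     infinity. *)
  destruct (Rle_or_lt 0 (sg * gap p t)) as [h | h]; [easy | exfalso].
  destruct (gap_near_infinity p (- (sg * gap p t)) t hp ltac:(lra)) as [r [hr hgr]].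
  assert (sg * gap p r <= sg * gap p t).
  { apply (sticky_scal_decr sg (gap p)
      (fun t => exp (2 * log_mean p t) * den p t - num p t)
      (fun t => / ((exp (2 * log_mean p t) + 1) * cosh (p * t) * cosh t))); try easy.
    - intros u hu. apply is_derive_gap. lra.
    - intros u hu. apply Rinv_0_lt_compat.
      pose proof (exp_pos (2 * log_mean p u)).
      pose proof (cosh_pos (p * u)). pose proof (cosh_pos u). prod_pos.
    - intros e s he hs.
      destruct (continuous_near_0 (gap p) e s) as [q [hq1 hq2]]; [| easy | easy |].
      + apply (ex_derive_continuous (gap p)). eexists. apply is_derive_gap. lra.
      + exists q. rewrite gap_0, Rminus_0_r in hq2. easy. }
  apply Rabs_def2 in hgr. destruct hsg as [-> | ->]; lra.
Qed.

(** * Monotonicity of power means, and return to [x] and [y] *)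

(** Both sides vanish at 0, and their derivatives in [t] differ by [tanh (p t) - tanh (q t)], which
    is [sinh ((p - q) t)] over a product of [cosh]. *)
Lemma log_mean_le (q p t : R) :
  0 < q <= p -> 0 <= t -> log_mean q t <= log_mean p t.
Proof.
  intros hqp [ht | <-]; [| rewrite !log_mean_0; lra].
  destruct (mean_value (fun t => log_mean p t - log_mean q t)
     (fun t => sinh (p * t) / cosh (p * t) - sinh (q * t) / cosh (q * t)) 0 t)
    as [c [hc e]]; [easy | |].
  { intros u _. apply (is_derive_minus (log_mean p) (log_mean q));
      apply is_derive_log_mean; lra. }
  rewrite !log_mean_0 in e.
  assert (0 <= sinh (p * c) / cosh (p * c) - sinh (q * c) / cosh (q * c)); [| nra].
  pose proof (cosh_pos (p * c)). pose proof (cosh_pos (q * c)).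
  replace (sinh (p * c) / cosh (p * c) - sinh (q * c) / cosh (q * c))
    with (sinh (p * c + - (q * c)) / (cosh (p * c) * cosh (q * c))).
  - apply Rdiv_le_0_compat; [| prod_pos].
    destruct (Rle_lt_or_eq_dec 0 (p * c + - (q * c)) ltac:(nra)) as [h | <-].
    + left. now apply sinh_pos.
    + rewrite sinh_0. lra.
  - unfold sinh, cosh in *.
    rewrite Ropp_plus_distr, Ropp_involutive, !exp_plus, !exp_Ropp in *.
    pose proof (exp_pos (p * c)). pose proof (exp_pos (q * c)).
    field. repeat split; nra.
Qed.

Lemma power_mean_exp (q g t : R) :
  0 < q -> power_mean q (exp (g + t)) (exp (g - t)) = exp (g + log_mean q t).
Proof.
  intros hq. unfold power_mean, Rpower. rewrite !ln_exp.
  replace ((exp (q * (g + t)) + exp (q * (g - t))) / 2) with (exp (q * g) * cosh (q * t)).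
  - rewrite ln_mult, ln_exp by (apply exp_pos || apply cosh_pos).
    f_equal. unfold log_mean. field. lra.
  - unfold cosh. rewrite Rmult_plus_distr_l, Rmult_minus_distr_l. unfold Rminus.
    rewrite !exp_plus. field.
Qed.

(** Since the square of [G / Mp] is [exp (- (2 * log_mean p t))], this writes the power of [A / Mp]
    as half of one plus that square, times a factor at most 1 exactly when [gap] is nonnegative. *)
Lemma Rpower_cosh_ratio (p t : R) :
  1 < p ->
  Rpower (cosh (1 * t) / exp (log_mean p t)) (p / (p - 1)) =
  (1 + exp (- (2 * log_mean p t))) / 2 * exp (- (gap p t / (p - 1))).
Proof.
  intros hp. set (L := log_mean p t).
  pose proof (cosh_pos (1 * t)) as hc. pose proof (exp_pos (2 * L)) as hm.
  unfold Rpower. rewrite ln_div, ln_exp by (easy || apply exp_pos).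
  replace ((1 + exp (- (2 * L))) / 2) with (exp (ln ((exp (2 * L) + 1) / 2) - 2 * L)).
  - rewrite <- exp_plus. f_equal. unfold gap. fold L. field. lra.
  - unfold Rminus. rewrite exp_plus, exp_ln, exp_Ropp by lra. field. lra.
Qed.

Theorem corollary1p5 (x y p : R) (hx : 0 < x) (hy : 0 < y) (hp : 2 < p) :
  let p' := p / (p - 1) in
  let A := (x + y) / 2 in
  let G := sqrt (x * y) in
  let Mp := power_mean p x y in
  let Mp' := power_mean p' x y in
  1 - Rpower (A / Mp) p' >= 1 / 2 * (1 - (G / Mp) ^ 2) /\
  1 / 2 * (1 - (G / Mp) ^ 2) >= 1 / 2 * (1 - (G / Mp') ^ 2) /\
  1 / 2 * (1 - (G / Mp') ^ 2) >= 1 - Rpower (A / Mp') p.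
Proof.
  intros p' A G Mp Mp'.
  (* The absolute value spares ordering [x] and [y]: the means depend on [t0] only through the even
     function [cosh], while [gap_sign] needs [0 <= t]. *)
  set (g := (ln x + ln y) / 2). set (t0 := (ln x - ln y) / 2). set (t := Rabs t0).
  assert (ht : 0 <= t) by apply Rabs_pos.
  assert (ex : x = exp (g + t0))
    by (rewrite <- (exp_ln x) at 1 by easy; f_equal; unfold g, t0; lra).
  assert (ey : y = exp (g - t0))
    by (rewrite <- (exp_ln y) at 1 by easy; f_equal; unfold g, t0; lra).
  assert (eM : forall q, 0 < q -> power_mean q x y = exp g * exp (log_mean q t)).
  { intros q hq. rewrite ex, ey, power_mean_exp, exp_plus by easy.
    unfold log_mean, t. now rewrite cosh_Rabs. }
  assert (eA : A = exp g * cosh (1 * t)).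
  { unfold A, t. rewrite ex, ey, cosh_Rabs, Rmult_1_l. unfold cosh, Rminus.
    rewrite !exp_plus. field. }
  assert (eG : G = exp g).
  { unfold G. rewrite ex, ey, <- exp_plus.
    replace (g + t0 + (g - t0)) with (g + g) by ring.
    rewrite exp_plus. apply sqrt_square. left. apply exp_pos. }
  assert (hp' : 1 < p' < 2).
  { unfold p'. split.
    - apply (Rmult_lt_reg_r (p - 1)); [lra |].
      unfold Rdiv. rewrite Rmult_assoc, Rinv_l; lra.
    - apply (Rmult_lt_reg_r (p - 1)); [lra |].
      unfold Rdiv. rewrite Rmult_assoc, Rinv_l; lra. }
  assert (epp : p = p' / (p' - 1)) by (unfold p'; field; lra).
  pose proof (exp_pos g) as hg.
  assert (eGM : forall q, 0 < q ->
    (G / power_mean q x y) ^ 2 = exp (- (2 * log_mean q t))).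
  { intros q hq. rewrite eG, eM by easy. pose proof (exp_pos (log_mean q t)).
    replace (- (2 * log_mean q t)) with (- log_mean q t + - log_mean q t) by ring.
    rewrite exp_plus, exp_Ropp. field. lra. }
  assert (eAM : forall q, 0 < q ->
    A / power_mean q x y = cosh (1 * t) / exp (log_mean q t)).
  { intros q hq. rewrite eA, eM by easy. pose proof (exp_pos (log_mean q t)).
    field. lra. }
  assert (hi : forall q, 1 < q -> 0 < / (q - 1))
    by (intros; apply Rinv_0_lt_compat; lra).
  unfold Mp, Mp'. rewrite !eGM, !eAM by lra.
  pose proof (exp_pos (- (2 * log_mean p t))).
  pose proof (exp_pos (- (2 * log_mean p' t))).
  repeat split.
  - unfold p' at 1. rewrite Rpower_cosh_ratio by lra.
    pose proof (gap_sign 1 p t ltac:(lra) ht) as h.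
    assert (exp (- (gap p t / (p - 1))) <= 1); [| nra].
    apply (Rle_trans _ (exp 0)); [| rewrite exp_0; lra].
    apply exp_le_compat. unfold Rdiv.
    pose proof (Rmult_le_pos _ _ h (Rlt_le _ _ (hi p ltac:(lra)))). lra.
  - pose proof (log_mean_le p' p t ltac:(lra) ht) as h.
    pose proof (exp_le_compat (- (2 * log_mean p t)) (- (2 * log_mean p' t)) ltac:(lra)).
    lra.
  (* The exponent [p] is conjugate to [p'], so this is the first inequality reversed, at the order
     [p'] in [(1, 2)], where [gap] is nonpositive. *)
  - rewrite epp at 1. rewrite Rpower_cosh_ratio by lra.
    pose proof (gap_sign (-1) p' t ltac:(lra) ht) as h.
    assert (1 <= exp (- (gap p' t / (p' - 1)))); [| nra].
    apply (Rle_trans _ (exp 0)); [rewrite exp_0; lra |].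
    apply exp_le_compat. unfold Rdiv.
    pose proof (Rmult_le_pos _ _ h (Rlt_le _ _ (hi p' ltac:(lra)))). lra.
Qed.
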